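(* Let $k\ge 2$. If $C$ is a $k$-banner pure normal simplicial complex on $n$ vertices, then for every two distinct facets $F_1$ and $F_2$ of $C$ there is a monotone conservative path from $F_1$ to $F_2$ whose length is at most $n2^{k-2}$.
   Context: All simplicial complexes are finite. A complex is pure of dimension $d-1$ (a $(d-1)$-complex) if all its facets (inclusion-maximal faces) have $d$ elements. Two facets are adjacent if they differ in a single vertex; this defines the dual graph. A dual path is a path $[F_0,\dots,F_N]$ in the dual graph, and its length is $N$. A pure complex is normal if between every two facets $F,F'$ there is a dual path consisting only of facets containing $F\cap F'$. The link of a vertex $v$ is $\mathrm{lk}_C(v)=\{f\in C: v\notin f,\ f\cup\{v\}\in C\}$. Banner complexes. A critical clique of $C$ is a set $T$ of vertices forming a clique in the 1-skeleton of $C$ such that $T\setminus\{v\}$ is a face of $C$ for some $v\in T$. $C$ is $k$-banner if every critical clique of size at least $k+1$ is a face of $C$. Vertex-distance. $\mathrm{vdist}_C(u,v)$ is the graph distance in the 1-skeleton of $C$, and $\mathrm{vdist}_C(S,S')=\min_{u\in S,v\in S'}\mathrm{vdist}_C(u,v)$, equal to $\infty$ if $S$ or $S'$ is empty. If $\dim C=0$, then for nonempty $S,S'$ one sets $\mathrm{vdist}_C(S,S')=0$ if $S\cap S'\neq\emptyset$ and $1$ otherwise. Vector of distances. Let $F=(v_1,\dots,v_d)$ be an ordered facet (a facet with an ordering of its vertices) of a pure $(d-1)$-complex $C$ and $S$ a set of vertices of $C$ (target set). The vector of distances $(\lambda_1,\dots,\lambda_d)$ from $F$ to $S$ is defined recursively: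 $\lambda_1=\mathrm{vdist}_C(v_1,S)$, and $(\lambda_2,\dots,\lambda_d)$ is the vector of distances from $F\setminus v_1$ (with induced order) to $S'$ in $\mathrm{lk}_C(v_1)$, where, with $V_1$ the vertex set of $\mathrm{lk}_C(v_1)$, $S'=\{v\in V_1:\mathrm{vdist}_C(v,S)=\mathrm{vdist}_C(v_1,S)-1\}$ if $v_1\notin S$, and $S'=S\cap V_1$ if $v_1\in S$. (If the target set is empty at some stage, all entries from there on are $\infty$.) The ordering is admissible with respect to $S$ if $\lambda_1=\mathrm{vdist}_C(F,S)$ and $F\setminus v_1$ is admissible with respect to $S'$ in $\mathrm{lk}_C(v_1)$ (the empty ordered facet is admissible). Monotone conservative paths. Let $C$ be pure and normal, $S$ a nonempty target set, and $[F_0,\dots,F_N]$ a dual path of ordered facets. It is monotone towards $S$ if the vectors of distances of $F_0,\dots,F_N$ to $S$ are strictly lexicographically decreasing. The index of a step from $F_{i-1}=(v_1,\dots,v_d)$ to $F_i=(v_1',\dots,v_d')$ is the minimum $k$ with $v_k\neq v_k'$. The step is conservative towards $S$ if (i) the vertex in $F_{i-1}\setminus F_i$ is the last vertex in the ordering of $F_{i-1}$, and (ii) the ordering of $F_i$ is admissible with respect to $S$ and has the maximum index among all admissible reorderings of $F_i$. The path is conservative towards $S$ if $F_0$ is admissible with respect to $S$ and every step is conservative. A monotone conservative path from a facet $F$ to a facet $F'$ is a dual path of ordered facets that starts at $F$, ends at $F'$, and is monotone and conservative towards the target set $S=F'$. *)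

(* Defs.v *)
From mathcomp Require Import all_boot.

Set Implicit Arguments.
Unset Strict Implicit.
Unset Printing Implicit Defensive.

(* Distances lie in nat extended by infinity, represented by [None]. *)

Definition dlt (a b : option nat) : bool :=
  match a, b with
  | Some m, Some n => m < n
  | Some _, None => true
  | None, _ => false
  end.

Definition dmin (a b : option nat) : option nat := if dlt b a then b else a.

Fixpoint lexlt (s t : seq (option nat)) : bool :=
  match s, t with
  | a :: s', b :: t' => dlt a b || ((a == b) && lexlt s' t')
  | _, _ => false
  end.

Section Complexes.
Variable V : finType.
Implicit Types (C : {set {set V}}) (F G S T : {set V}) (u v : V).
Implicit Types (s t : seq V) (p : seq (seq V)).

Definition is_complex C : Prop :=
  set0 \in C /\ forall F G, F \in C -> G \subset F -> G \in C.

(* The elements of V that do not occur in C are not vertices of C. *)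
Definition verts C : {set V} := [set v | [set v] \in C].

Definition facet C F : bool := maxset (fun f => f \in C) F.

(* Pure of dimension d - 1. *)
Definition pure d C : Prop := forall F, facet C F -> #|F| = d.

Definition dual_adj C F G : bool :=
  [&& facet C F, facet C G, #|F :\: G| == 1 & #|G :\: F| == 1].

Definition normal C : Prop :=
  forall F G, facet C F -> facet C G ->
  exists P : seq {set V},
    [/\ path (dual_adj C) F P, last F P = G
      & all (fun H : {set V} => F :&: G \subset H) (F :: P)].

Definition link C v : {set {set V}} :=
  [set f in C | (v \notin f) && (v |: f \in C)].

Definition skel C u v : bool := (u != v) && ([set u; v] \in C).

Definition is_clique C T : Prop :=
  T \subset verts C /\ {in T &, forall u v, u != v -> skel C u v}.

Definition critical_clique C T : Prop :=
  is_clique C T /\ exists2 v, v \in T & T :\ v \in C.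

Definition banner k C : Prop :=
  forall T, critical_clique C T -> k.+1 <= #|T| -> T \in C.

Definition walk C n u v : bool :=
  [exists q : n.-tuple V, path (skel C) u q && (last u q == v)].

(* A shortest walk repeats no vertex, so only lengths below #|V| matter. *)
Definition gdist C u v : option nat :=
  ohead [seq n <- iota 0 #|V| | walk C n u v].

Definition dim0 C : bool := \max_(f in C) #|f| == 1.

Definition vdist C S T : option nat :=
  if dim0 C then
    if (S == set0) || (T == set0) then None
    else Some (if S :&: T != set0 then 0 else 1)
  else \big[dmin/None]_(u in S) \big[dmin/None]_(v in T) gdist C u v.

(* When v is at infinite distance from S (e.g. S is empty) the new target set
   is empty, so that all the following distances are infinite too. *)
Definition target C S v : {set V} :=
  if v \in S then S :&: verts (link C v)
  else if vdist C [set v] S is Some m.+1 then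
    [set w in verts (link C v) | vdist C [set w] S == Some m]
  else set0.

Fixpoint vecdist C S s : seq (option nat) :=
  if s is v :: s' then
    vdist C [set v] S :: vecdist (link C v) (target C S v) s'
  else [::].

Fixpoint admissible C S s : bool :=
  if s is v :: s' then
    (vdist C [set v] S == vdist C [set x in s] S)
    && admissible (link C v) (target C S v) s'
  else true.

Definition ordered_facet C s : bool := uniq s && facet C [set x in s].

(* A path is given by its first ordered facet s and the list p of the others;
   its length is therefore size p. *)
Definition ordered_dual_path C s p : bool :=
  all (ordered_facet C) (s :: p)
  && path (fun t t' => dual_adj C [set x in t] [set x in t']) s p.

Definition monotone_path C S s p : bool :=
  sorted (fun a b => lexlt b a) [seq vecdist C S t | t <- s :: p].

(* Positions in an ordered facet are counted from 1. *)
Definition step_index s t : nat := (find (fun c => c.1 != c.2) (zip s t)).+1.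

Definition conservative_step C S s t : bool :=
  [&& [forall v, (v \in s) && (v \notin t) ==> (last v s == v)],
      admissible C S t
    & all (fun t' => admissible C S t' ==> (step_index s t' <= step_index s t))
          (permutations t)].

Definition conservative_path C S s p : bool :=
  admissible C S s && path (conservative_step C S) s p.

Definition monotone_conservative_path C F G s p : Prop :=
  [/\ ordered_dual_path C s p,
      [set x in s] = F,
      [set x in last s p] = G,
      monotone_path C G s p
    & conservative_path C G s p].

End Complexes.

(* Main.v *)
Require Import Defs.
From mathcomp Require Import all_boot.
From mathcomp Require Import zify.

(* Existence: if the last vertex of an admissible facet is replaced by a vertex
   of the last iterated target set, then the new facet is reordered by keeping
   the old order as long as this is admissible; the first new head is then the
   entering vertex, the vector of distances drops there, and every other
   admissible ordering departs from the old one no later.  Towards a target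
   facet the iterated target sets are nonempty until the target is reached.

   Length: it suffices that every vertex w enters at most 2 ^ (k - 2) times.
   Along the path the first vertex changes only when its distance l to the
   target drops by one.  A facet containing w has l = m or l = m - 1, where m
   is the distance of w, so w occurs in at most two blocks with constant first
   vertex v.  Each of them is a path in the link of v, which is (k - 1)-banner;
   this doubles the bound when k increases by one.  For k = 2 the complex is
   flag, and then a vertex never returns after it has left. *)

Set Implicit Arguments.
Unset Strict Implicit.
Unset Printing Implicit Defensive.

Section Paths.
Variable V : finType.
Implicit Types (C : {set {set V}}) (F G S T : {set V}) (u v w x : V).
Implicit Types (s t : seq V) (p q : seq (seq V)).

(** * Vertex distances: minima, walks and adjacency *)

Lemma complex_sub C F G : is_complex C -> F \in C -> G \subset F -> G \in C.
Proof. by case=> _; apply. Qed.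

Lemma dim0_pair C F u v : dim0 C -> F \in C -> u \in F -> v \in F -> u = v.
Proof.
move=> /eqP dC FC uF vF.
have: #|F| <= 1 by rewrite -dC; apply: (bigmax_sup F).
by move/card_le1_eqP=> h; apply: h.
Qed.

Lemma big_dminP (r : seq V) (P : pred V) (f : V -> option nat) :
  (\big[dmin/None]_(u <- r | P u) f u = None) \/
  exists u, [/\ u \in r, P u & \big[dmin/None]_(u <- r | P u) f u = f u].
Proof.
elim: r => [|a r IH]; first by rewrite big_nil; left.
rewrite big_cons; case: ifP => Pa; last first.
  by case: IH => [->|[u [ur Pu ->]]]; [left | right; exists u; rewrite inE ur orbT].
rewrite {1 3}/dmin; case: ifP => _; last by right; exists a; rewrite mem_head.
case: IH => [->|[u [ur Pu ->]]]; first by left.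
by right; exists u; rewrite inE ur orbT.
Qed.

Lemma big_dmin_le (r : seq V) (P : pred V) (f : V -> option nat) u :
  u \in r -> P u -> dlt (f u) (\big[dmin/None]_(u <- r | P u) f u) = false.
Proof.
elim: r => [//|a r IH]; rewrite inE big_cons => /orP[/eqP ->|ur] Pu.
  rewrite Pu /dmin; case: ifP => //; case: (f a) (\big[_/_]_(_ <- _ | _) _) => [m|] [n|] //=; lia.
have {}IH := IH ur Pu; case: ifP => // _; rewrite /dmin; case: ifP => //.
case: (f a) (\big[_/_]_(_ <- _ | _) _) (f u) IH => [m|] [n|] [l|] //=; lia.
Qed.

Lemma gdist_walk C u v m : gdist C u v = Some m -> walk C m u v /\ m < #|V|.
Proof.
rewrite /gdist => h.
have: m \in [seq n <- iota 0 #|V| | walk C n u v].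
  by case: filter h => //= a l [->]; rewrite mem_head.
by rewrite mem_filter mem_iota => /andP[-> /=].
Qed.

(** Removing loops makes the walk repetition-free, hence shorter than [#|V|], so the search in
    [gdist] sees it; the head of the increasing filtered list is the least length. *)
Lemma walk_gdist C u v m :
  walk C m u v -> exists2 l, l <= m & gdist C u v = Some l.
Proof.
case/existsP => q /andP[Pq /eqP Lq].
have [l [lm lV wl]] : exists l, [/\ l <= m, l < #|V| & walk C l u v].
  move: Lq (size_tuple q); case/shortenP: Pq => q' Pq' Uq' sub Lq sq.
  exists (size q'); split.
  - rewrite -sq; apply: uniq_leq_size; last by [].
    by case/andP: Uq'.
  - by move/card_uniqP: Uq' => /= <-; apply: max_card.
  - by apply/existsP; exists (in_tuple q'); rewrite Pq' Lq eqxx.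
rewrite /gdist.
have: l \in [seq n <- iota 0 #|V| | walk C n u v].
  by rewrite mem_filter wl mem_iota.
have: sorted ltn [seq n <- iota 0 #|V| | walk C n u v].
  by apply: sorted_filter; [apply: ltn_trans | apply: iota_ltn_sorted].
case: filter => //= a r pa; rewrite inE => lr; exists a => //.
apply: leq_trans lm; case/orP: lr => [/eqP->//|lr].
by move: pa; rewrite (path_sortedE ltn_trans) => /andP[/allP/(_ _ lr)/ltnW].
Qed.

Lemma vdist1E C S v : ~~ dim0 C ->
  vdist C [set v] S = \big[dmin/None]_(u in S) gdist C v u.
Proof. by rewrite /vdist => /negbTE->; rewrite big_set1E; case: (\big[_/_]_(_ in _) _) => [m|]. Qed.

Lemma vdist_walk C S v m : ~~ dim0 C ->
  vdist C [set v] S = Some m -> exists2 u, u \in S & walk C m v u.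
Proof.
move=> nC; rewrite vdist1E //.
case: (big_dminP (index_enum V) (mem S) (gdist C v)) => [->//|[u [_ uS ->]]].
by move/gdist_walk=> [w _]; exists u.
Qed.

Lemma walk_vdist C S u v m : ~~ dim0 C -> u \in S -> walk C m v u ->
  exists2 l, l <= m & vdist C [set v] S = Some l.
Proof.
move=> nC uS /walk_gdist[l lm gl]; rewrite vdist1E //.
have := big_dmin_le (gdist C v) (mem_index_enum u) uS; rewrite gl.
case: (\big[_/_]_(_ <- _ | _) _) => //= l' /negbT; rewrite -leqNgt => l'l.
by exists l' => //; apply: leq_trans l'l lm.
Qed.

Definition cardV : nat := #|V|.

Lemma vdist_bound C S v m : vdist C [set v] S = Some m -> m <= cardV.
Proof.
case: (boolP (dim0 C)) => [dC|nC].
  rewrite /vdist dC; case: ifP => // _ [<-]; case: ifP => // _.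
  by apply/card_gt0P; exists v.
rewrite vdist1E //.
case: (big_dminP (index_enum V) (mem S) (gdist C v)) => [->//|[u [_ uS ->]]].
by move/gdist_walk=> [_ /ltnW].
Qed.

Lemma vdist0 C S v : (vdist C [set v] S == Some 0) = (v \in S).
Proof.
case: (boolP (dim0 C)) => [dC|nC].
  rewrite /vdist dC; have /negbTE -> /= : [set v] != set0.
    by apply/set0Pn; exists v; rewrite inE.
  case: (eqVneq S set0) => [->|_]; first by rewrite inE.
  case: ifPn => [/set0Pn[x]|/negPn]; first by rewrite !inE => /andP[/eqP->].
  by rewrite setI_eq0 disjoints1 => /negbTE ->.
apply/eqP/idP => [/vdist_walk[//|u uS]|vS].
  by rewrite /walk => /existsP[q]; rewrite tuple0 /= => /eqP->.
have [|[|l] //] := @walk_vdist C S v v 0 nC vS.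
by apply/existsP; exists [tuple]; rewrite /= eqxx.
Qed.

Lemma vdist_adj C S F u v m : is_complex C -> F \in C -> u \in F -> v \in F ->
  vdist C [set v] S = Some m ->
  exists2 l, l <= m.+1 & vdist C [set u] S = Some l.
Proof.
move=> cC FC uF vF; case: (eqVneq u v) => [->|uv]; first by exists m.
case: (boolP (dim0 C)) => [dC|nC].
  by rewrite (dim0_pair dC FC uF vF) eqxx in uv.
case/vdist_walk => // z zS /existsP[q /andP[Pq Lq]].
apply: (@walk_vdist _ _ z) => //; apply/existsP; exists [tuple of v :: q] => /=.
rewrite /skel uv Pq Lq /= !andbT; apply: complex_sub FC _ => //.
by rewrite subUset !sub1set uF.
Qed.

Lemma in_verts_link C v w : is_complex C ->
  (w \in verts (link C v)) = (w != v) && ([set v; w] \in C).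
Proof.
move=> cC; rewrite inE [LHS]inE in_set1 (eq_sym v w).
case: (boolP ([set v; w] \in C)) => [vwC|]; last by rewrite !andbF.
have -> : [set w] \in C.
  by apply: complex_sub vwC _; rewrite // sub1set !inE eqxx orbT.
by rewrite !andbT.
Qed.

(** [w] is the second vertex of a shortest walk from [v] to [S]; being adjacent to [v], it cannot be
    closer than [m]. *)
Lemma vdist_step C S v m : is_complex C -> ~~ dim0 C ->
  vdist C [set v] S = Some m.+1 ->
  exists2 w, w \in verts (link C v) & vdist C [set w] S = Some m.
Proof.
move=> cC nC h; have [u uS /existsP[[[//|w q] sq] /=]] := vdist_walk nC h.
rewrite -andbA => /and3P[/andP[vw vwC] Pq Lq].
exists w; first by rewrite in_verts_link // eq_sym vw.
have wq: walk C m w u by apply/existsP; exists (Tuple (sq : size q == m)); rewrite /= Pq.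
have [l lm hl] := walk_vdist nC uS wq.
have [l' l'l] := vdist_adj cC vwC (set21 v w) (set22 v w) hl.
by rewrite h => -[e]; rewrite hl; congr Some; lia.
Qed.

(* Infinity becomes [#|V| + 2], which is larger than every finite distance and
   not the successor of one (in dimension 0 the value 1 may equal [#|V|]). *)
Definition dist C S v := odflt cardV.+2 (vdist C [set v] S).

Lemma dist_Some C S v : dist C S v <= cardV.+1 -> vdist C [set v] S = Some (dist C S v).
Proof. by rewrite /dist; case: vdist => //=; rewrite ltnn. Qed.

Lemma vdist_dist C S v m : vdist C [set v] S = Some m -> dist C S v = m /\ m <= cardV.
Proof. by move=> h; rewrite /dist h (vdist_bound h). Qed.

(** The code of infinity exceeds every finite distance, so [dist] determines [vdist], even across
    different complexes. *)
Lemma vdist_inj C C' S S' u v :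
  dist C S u = dist C' S' v -> vdist C [set u] S = vdist C' [set v] S'.
Proof.
rewrite /dist; case hu: (vdist C _ _) => [a|]; case hv: (vdist C' _ _) => [b|] //= e.
- by rewrite e.
- by have := vdist_bound hu; rewrite e => /ltnW; rewrite ltnn.
- by have := vdist_bound hv; rewrite -e => /ltnW; rewrite ltnn.
Qed.

Lemma dlt_vdist C S u v :
  dlt (vdist C [set u] S) (vdist C [set v] S) = (dist C S u < dist C S v).
Proof.
rewrite /dist; case hu: (vdist C [set u] _) => [a|]; case hv: (vdist C [set v] _) => [b|] //=.
- by have := vdist_bound hu; lia.
- by have := vdist_bound hv; lia.
- lia.
Qed.

Lemma dist0 C S v : (dist C S v == 0) = (v \in S).
Proof. by rewrite -(vdist0 C) /dist; case: vdist. Qed.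

Lemma dist_adj C S F u v : is_complex C -> F \in C -> u \in F -> v \in F ->
  dist C S u <= (dist C S v).+1.
Proof.
move=> cC FC uF vF; rewrite {2}/dist; case hv: vdist => [m|] /=.
  by have [l lm hl] := vdist_adj cC FC uF vF hv; have [-> _] := vdist_dist hl.
by rewrite /dist; case hu: vdist => [a|] //=; have := vdist_bound hu; lia.
Qed.

Lemma dist_fin_adj C S F u v : is_complex C -> F \in C -> u \in F -> v \in F ->
  dist C S v <= cardV.+1 -> dist C S u <= cardV.+1.
Proof.
move=> cC FC uF vF /dist_Some hv; have [l _ hl] := vdist_adj cC FC uF vF hv.
by have [-> h] := vdist_dist hl; lia.
Qed.

(** One formula also covers [v] at infinite distance: [dist] never takes the value [cardV.+1], so no
    [w] is then one closer and the target is empty. *)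
Lemma in_target C S v w : is_complex C ->
  (w \in target C S v) = (w \in verts (link C v)) &&
    (if v \in S then w \in S else (dist C S w).+1 == dist C S v).
Proof.
move=> cC; rewrite /target; case: ifP => vS; first by rewrite inE andbC.
case hv: vdist => [[|m]|].
- by move: vS; rewrite -(vdist0 C) hv.
- rewrite [LHS]inE; congr andb; have [-> mV] := vdist_dist hv.
  by rewrite /dist; case hw: vdist => [l|] //=; apply/esym/negbTE; lia.
- rewrite inE {2}/dist hv /= eqSS; symmetry; apply/negbTE.
  rewrite negb_and; apply/orP.
  case: (boolP (w \in verts _)); [right | by left].
  rewrite /dist; case hw: vdist => [l|] //=; last by lia.
  by have := vdist_bound hw; lia.
Qed.

Lemma vdist_attained C S F : F != set0 ->
  (exists2 u, u \in F & vdist C F S = vdist C [set u] S) /\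
  (forall u, u \in F -> ~~ dlt (vdist C [set u] S) (vdist C F S)).
Proof.
move=> nF; have [x xF] := set0Pn _ nF; have x0 y : ([set y] == set0 :> {set V}) = false.
  by apply/negbTE/set0Pn; exists y; rewrite inE.
case: (boolP (dim0 C)) => [dC|nC]; last first.
  have E: vdist C F S = \big[dmin/None]_(u in F) vdist C [set u] S.
    by rewrite {1}/vdist (negbTE nC); apply: eq_bigr => u _; rewrite vdist1E.
  rewrite E; split=> [|u uF]; last by rewrite big_dmin_le ?mem_index_enum.
  case: (big_dminP (index_enum V) (mem F) (fun u => vdist C [set u] S)) =>
    [e|[u [_ uF e]]]; last by exists u.
  exists x => //; have := big_dmin_le (fun u => vdist C [set u] S) (mem_index_enum x) xF.
  by rewrite e; case: vdist.
rewrite /vdist dC (negbTE nF) /=; case: eqVneq => [_|nS].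
  by split=> [|u _]; rewrite ?orbT //; exists x => //; rewrite orbT.
case: (eqVneq (F :&: S) set0) => [e|/set0Pn[y]] /=.
  have h u : u \in F -> [set u] :&: S = set0.
    move=> uF; apply/eqP; rewrite setI_eq0 disjoints1; apply/negP => uS.
    by have : u \in F :&: S; [rewrite inE uF | rewrite e inE].
  split=> [|u uF]; last by rewrite x0 /= h // eqxx.
  by exists x => //; rewrite x0 /= h // eqxx.
rewrite inE => /andP[yF yS]; split=> [|u uF]; last by rewrite x0.
exists y => //; rewrite x0 /=; case: (eqVneq ([set y] :&: S) set0) => // /eqP.
by rewrite setI_eq0 disjoints1 yS.
Qed.

(** The distance from a nonempty set is attained at one of its vertices, so admissibility says that
    the head is a nearest vertex, recursively in the links. *)
Lemma admissible_cons C S v s :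
  admissible C S (v :: s) =
  all (fun x => dist C S v <= dist C S x) s && admissible (link C v) (target C S v) s.
Proof.
rewrite /=; congr andb; have nF: [set x in v :: s] != set0.
  by apply/set0Pn; exists v; rewrite inE mem_head.
have [[u uF eu] mF] := vdist_attained C S nF.
have {}mF y : y \in v :: s -> dist C S u <= dist C S y.
  by move=> ys; have := mF y; rewrite inE eu dlt_vdist -leqNgt; apply.
rewrite inE in uF; rewrite eu; apply/eqP/allP => [e x xs|h].
  by rewrite {1}/dist e mF // inE xs orbT.
apply: vdist_inj; apply/eqP; rewrite eqn_leq (mF v) ?mem_head // andbT.
by move: uF; rewrite inE => /orP[/eqP->|/h].
Qed.

(** * Links inherit purity, normality and the banner property *)

Lemma in_link C v F : (F \in link C v) = [&& F \in C, v \notin F & v |: F \in C].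
Proof. by rewrite inE. Qed.

Lemma facetP C F :
  reflect (F \in C /\ forall G, G \in C -> F \subset G -> G = F) (facet C F).
Proof. exact: maxsetP. Qed.

Lemma link_complex C v : is_complex C -> v \in verts C -> is_complex (link C v).
Proof.
move=> cC; rewrite inE => vC; split.
  by rewrite in_link setU0 vC inE; case: cC => ->.
move=> F G; rewrite !in_link => /and3P[FC vF vFC] GF; apply/and3P; split.
- exact: complex_sub FC GF.
- by apply: contra vF; apply: subsetP.
- by apply: complex_sub vFC _ => //; apply: setUS.
Qed.

Lemma facet_link C v F : is_complex C ->
  facet (link C v) F = (v \notin F) && facet C (v |: F).
Proof.
move=> cC; apply/facetP/andP => [[]|[vF /facetP[vFC mF]]].
  rewrite in_link => /and3P[FC vF vFC] mF; split=> //; apply/facetP; split=> // G GC.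
  rewrite subUset sub1set => /andP[vG FG].
  have e : v |: G :\ v = G by rewrite setD1K.
  suff <- : G :\ v = F by [].
  apply: mF; last by rewrite subsetD1 FG.
  rewrite in_link setD11 e GC !andbT; apply: complex_sub GC _ => //; exact: subD1set.
split=> [|G].
  by rewrite in_link vF vFC !andbT; apply: complex_sub vFC _ => //; apply: subsetUr.
rewrite in_link => /and3P[GC vG vGC] FG.
by rewrite -(setU1K vG) (mF (v |: G)) ?setUS // setU1K.
Qed.

Lemma facet_linkD C v F : is_complex C -> facet C F -> v \in F -> facet (link C v) (F :\ v).
Proof. by move=> cC fF vF; rewrite facet_link // setD11 setD1K. Qed.

Lemma facet_vert C F v : is_complex C -> facet C F -> v \in F -> v \in verts C.
Proof.
by move=> cC /facetP[FC _] vF; rewrite inE; apply: complex_sub FC _; rewrite // sub1set.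
Qed.

Lemma link_pure C d v : is_complex C -> pure d C -> pure d.-1 (link C v).
Proof.
move=> cC pC F; rewrite facet_link // => /andP[vF /pC <-].
by rewrite cardsU1 vF.
Qed.

Lemma dual_adj_link C v F G : is_complex C -> v \in F -> v \in G ->
  dual_adj C F G -> dual_adj (link C v) (F :\ v) (G :\ v).
Proof.
move=> cC vF vG /and4P[fF fG h1 h2]; rewrite /dual_adj !facet_linkD //=.
have E (H K : {set V}) : v \in H -> v \in K -> (H :\ v) :\: (K :\ v) = H :\: K.
  by move=> vH vK; apply/setP=> x; rewrite !inE; case: (eqVneq x v) => [->|]; rewrite ?vH ?vK.
by rewrite !E // h1 h2.
Qed.

(** A dual path between [v |: F] and [v |: G] through facets containing their intersection keeps [v]
    throughout; deleting [v] gives a path in the link. *)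
Lemma link_normal C v : is_complex C -> normal C -> normal (link C v).
Proof.
move=> cC nC F G; rewrite !facet_link // => /andP[vF fF] /andP[vG fG].
have [P [pP lP aP]] := nC _ _ fF fG; exists [seq H :\ v | H <- P].
have {}aP : forall H, H \in (v |: F) :: P -> v |: (F :&: G) \subset H.
  move=> H /(allP aP); apply: subset_trans; apply/subsetP=> x.
  by rewrite !inE; case: eqP.
have E (H : {set V}) : v \notin H -> (v |: H) :\ v = H by apply: setU1K.
have eF : F = (v |: F) :\ v by rewrite E.
split; last 2 first.
- by rewrite {1}eF (last_map (fun H : {set V} => H :\ v)) lP E.
- apply/allP=> H; rewrite inE => /orP[/eqP->|/mapP[K KP ->]]; first exact: subsetIl.
  have := aP K; rewrite inE KP orbT => /(_ isT); rewrite subUset sub1set => /andP[vK sK].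
  by rewrite subsetD1 sK inE negb_and vF.
have {aP} vin H : H \in (v |: F) :: P -> v \in H.
  by move/aP; rewrite subUset sub1set => /andP[].
rewrite {1}eF; elim: P (v |: F) pP vin {lP fF eF} => //= K P IH H /andP[HK pP] vin.
rewrite dual_adj_link ?vin ?inE ?eqxx ?orbT //=.
by apply: IH => // L LP; apply: vin; rewrite inE LP orbT.
Qed.

(** Adding [v] to a critical clique of the link gives a critical clique of [C] with one more vertex,
    critical at the same vertex [w]. *)
Lemma link_banner C k v : is_complex C -> banner k.+1 C -> banner k (link C v).
Proof.
move=> cC bC T [[Tv cT] [w wT wC]] kT.
have sub x : x \in T -> (x != v) && ([set v; x] \in C).
  by move=> xT; rewrite -in_verts_link //; apply: (subsetP Tv).
have vT : v \notin T by apply/negP => /sub; rewrite eqxx.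
have wv : w != v by case/andP: (sub _ wT).
suff h : v |: T \in C.
  by rewrite in_link vT h !andbT; apply: complex_sub h _ => //; apply: subsetUr.
apply: bC; last by rewrite cardsU1 vT.
have vC : v \in verts C.
  have /andP[_ h] := sub _ wT; rewrite inE; apply: complex_sub h _ => //.
  by rewrite sub1set set21.
split; first split.
- rewrite subUset sub1set vC; apply/subsetP=> x /sub/andP[_ h]; rewrite inE.
  by apply: complex_sub h _ => //; rewrite sub1set set22.
- move=> x y; rewrite !inE => /orP[/eqP->|xT] /orP[/eqP->|yT] xy.
  + by rewrite eqxx in xy.
  + by rewrite /skel xy; case/andP: (sub _ yT).
  + by rewrite /skel xy setUC; case/andP: (sub _ xT).
  + by have := cT _ _ xT yT xy; rewrite /skel xy /= in_link => /and3P[].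
exists w; first by rewrite !inE wT orbT.
move: wC; rewrite in_link => /and3P[_ _].
suff -> : (v |: T) :\ w = v |: (T :\ w) by [].
by apply/setP=> x; rewrite !inE; case: (eqVneq x v) => [->|] //=; rewrite eq_sym wv.
Qed.

(** The triangle is critical because removing [u] leaves an edge, and its size 3 is the threshold
    for [banner 2]. *)
Lemma flag3 C u v w : is_complex C -> banner 2 C ->
  u != v -> u != w -> v != w ->
  [set u; v] \in C -> [set u; w] \in C -> [set v; w] \in C ->
  [set u; v; w] \in C.
Proof.
move=> cC bC uv uw vw uvC uwC vwC.
have vtx x y : [set x; y] \in C -> (x \in verts C) && (y \in verts C).
  move=> h; rewrite !inE; apply/andP; split; apply: complex_sub h _ => //;
  by rewrite sub1set ?set21 ?set22.
have e : [set u; v; w] :\ u = [set v; w].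
  apply/setP=> x; rewrite !inE; case: (eqVneq x u) => [->|] //=.
  by rewrite (negbTE uv) (negbTE uw).
have c3 : #|[set u; v; w]| = 3 by rewrite (cardsD1 u) e cards2 vw !inE eqxx.
apply: bC; last by rewrite c3.
split; last by exists u; rewrite ?e // !inE eqxx.
split.
  have /andP[uC vC] := vtx _ _ uvC; have /andP[_ wC] := vtx _ _ vwC.
  by rewrite !subUset !sub1set uC vC wC.
move=> x y; rewrite /skel !inE => hx hy xy; rewrite xy /=.
have vuC : [set v; u] \in C by rewrite setUC.
have wuC : [set w; u] \in C by rewrite setUC.
have wvC : [set w; v] \in C by rewrite setUC.
by move: hx hy xy => /orP[/orP[]|] /eqP-> /orP[/orP[]|] /eqP->; rewrite ?eqxx.
Qed.

(** * Admissible ordered facets *)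

Lemma ordered_facet_cons C v s : is_complex C ->
  ordered_facet C (v :: s) = ordered_facet (link C v) s.
Proof.
move=> cC; rewrite /ordered_facet facet_link // set_cons inE /=.
by rewrite andbA; congr andb; rewrite andbC.
Qed.

Lemma ordered_facet_in C s x : is_complex C -> ordered_facet C s -> x \in s ->
  x \in verts C.
Proof. by move=> cC /andP[_ fs] xs; apply: (facet_vert cC fs); rewrite inE. Qed.

Lemma ordered_facet_face C s : ordered_facet C s -> [set x in s] \in C.
Proof. by case/andP=> _ /facetP[]. Qed.

Definition afacet C S s := ordered_facet C s && admissible C S s.

Lemma afacet_cons C S v s : is_complex C ->
  afacet C S (v :: s) =
  all (fun x => dist C S v <= dist C S x) s && afacet (link C v) (target C S v) s.
Proof.
by move=> cC; rewrite /afacet admissible_cons ordered_facet_cons // andbCA.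
Qed.

Lemma afacet_complex C S v s : is_complex C -> afacet C S (v :: s) -> is_complex (link C v).
Proof.
move=> cC /andP[os _]; apply: link_complex => //.
by apply: ordered_facet_in os _; rewrite ?mem_head.
Qed.

Lemma afacet_min C S v s x : is_complex C -> afacet C S (v :: s) ->
  x \in v :: s -> dist C S v <= dist C S x.
Proof.
by move=> cC; rewrite afacet_cons // => /andP[/allP h _]; rewrite inE => /orP[/eqP->|/h].
Qed.

Lemma afacet_max C S v s x : is_complex C -> afacet C S (v :: s) ->
  x \in v :: s -> dist C S x <= (dist C S v).+1.
Proof.
move=> cC /andP[/ordered_facet_face sC _] xs.
by apply: (dist_adj S cC sC); rewrite inE ?mem_head.
Qed.

Lemma afacet_pair C S s x y : is_complex C -> afacet C S s ->
  x \in s -> y \in s -> [set x; y] \in C.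
Proof.
move=> cC /andP[/ordered_facet_face sC _] xs ys; apply: complex_sub sC _ => //.
by rewrite subUset !sub1set !inE xs.
Qed.

(** * Steps and paths decomposed along links *)

(** A conservative step evicts the last vertex, so these are the vertices that survive it. *)
Definition front s := if s is v :: s' then belast v s' else [::].

Lemma front_rcons s x : front (rcons s x) = s.
Proof. by case: s => //= v s; rewrite belast_rcons. Qed.

Lemma mem_front s x : x \in front s -> x \in s.
Proof. by case/lastP: s => // s y; rewrite front_rcons mem_rcons inE orbC => ->. Qed.

Lemma uniq_front s : uniq s -> uniq (front s).
Proof. by case/lastP: s => // s y; rewrite front_rcons rcons_uniq => /andP[]. Qed.

Lemma front_cons v s : s != [::] -> front (v :: s) = v :: front s.
Proof. by case: s. Qed.

Lemma size_front s : s != [::] -> (size (front s)).+1 = size s.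
Proof. by case: s => //= v s; rewrite size_belast. Qed.

(* A conservative monotone step, decomposed along the iterated links: the head
   is kept, or the entering vertex, which is closer, becomes the head. *)
Fixpoint gstep C S s t : bool :=
  match s, t with
  | v :: s', v' :: t' =>
      if v == v' then gstep (link C v) (target C S v) s' t'
      else (dist C S v' < dist C S v) && perm_eq t' (front s)
  | _, _ => false
  end.

(** The entering vertex is new because it is closer than the head, which is nearest among the old
    vertices. *)
Lemma gstep_perm C S s t : is_complex C -> gstep C S s t ->
  afacet C S s -> uniq t -> exists2 x, x \notin s & perm_eq t (x :: front s).
Proof.
elim: s C S t => [|v s IH] C S [|v' t] //= cC; case: eqVneq => [<-|vv'].
  move=> st As /andP[vt ut].
  have As' : afacet (link C v) (target C S v) s by move: As; rewrite afacet_cons // => /andP[].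
  have [x xs pt] := IH _ _ _ (afacet_complex cC As) st As' ut.
  have nx : s != [::] by case: (s) st.
  exists x.
    by rewrite inE negb_or xs andbT; apply: contra vt => /eqP <-; rewrite (perm_mem pt) mem_head.
  rewrite -[belast v s]/(front (v :: s)) front_cons //.
  by rewrite -(perm_cons v) in pt; apply: perm_trans pt _; rewrite (perm_catCA [:: v] [:: x]).
move=> /andP[lt pt] As _; exists v'; last by rewrite perm_cons.
by apply: contraL lt => /(afacet_min cC As); rewrite leqNgt.
Qed.

Lemma gstep_neq0 C S s t : gstep C S s t -> (s != [::]) && (t != [::]).
Proof. by case: s t => [|v s] [|w t]. Qed.

Lemma gstep_size C S s t : gstep C S s t -> size t = size s.
Proof.
elim: s C S t => [|v s IH] C S [|v' t] //=; case: eqVneq => [_ /IH->//|_ /andP[_ /perm_size->]].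
by rewrite size_belast.
Qed.

Definition gpath C S s p := all (afacet C S) (s :: p) && path (gstep C S) s p.

Lemma gpath_cons C S s t p :
  gpath C S s (t :: p) = [&& afacet C S s, gstep C S s t & gpath C S t p].
Proof. by rewrite /gpath /= -!andbA; do !bool_congr. Qed.

Lemma gpath_nil C S s : gpath C S s [::] = afacet C S s.
Proof. by rewrite /gpath /= !andbT. Qed.

Lemma gpath_head C S s p : gpath C S s p -> afacet C S s.
Proof. by case/andP=> /andP[]. Qed.

Lemma gpath_all C S s p t : gpath C S s p -> t \in s :: p -> afacet C S t.
Proof. by case/andP=> /allP h _ /h. Qed.

Lemma gpath_size C S s p t : gpath C S s p -> t \in s :: p -> size t = size s.
Proof.
elim: p s => [|r p IH] s; first by rewrite inE => _ /eqP->.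
rewrite gpath_cons => /and3P[_ sr rp]; rewrite inE => /orP[/eqP->//|/(IH _ rp) ->].
exact: gstep_size sr.
Qed.

Lemma gpath_catl C S s p q : gpath C S s (p ++ q) -> gpath C S s p.
Proof. by rewrite /gpath cat_path -cat_cons all_cat => /andP[/andP[-> _] /andP[->]]. Qed.

Lemma gpath_catr C S s p t q : gpath C S s (p ++ t :: q) ->
  gstep C S (last s p) t /\ gpath C S t q.
Proof.
rewrite /gpath cat_path -cat_cons all_cat => /andP[/andP[_ At] /and3P[_ st tq]].
by rewrite At.
Qed.

Lemma gpath_link C S v s q : is_complex C ->
  gpath C S (v :: s) (map (cons v) q) -> gpath (link C v) (target C S v) s q.
Proof.
move=> cC; elim: q s => [|t q IH] s.
  by rewrite !gpath_nil afacet_cons // => /andP[].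
rewrite [map _ _]/= !gpath_cons afacet_cons // => /and3P[/andP[_ ->] /=].
by rewrite eqxx => -> /IH ->.
Qed.

(** Cuts off the first block: the longest initial stretch with head [v], which is a path in the link
    of [v]. *)
Lemma gpath_split C S v s p : gpath C S (v :: s) p ->
  exists q p2, p = map (cons v) q ++ p2 /\
    (p2 = [::] \/ exists x t p3, p2 = (x :: t) :: p3 /\ x != v).
Proof.
elim: p s => [|[|x t] p IH] s; first by exists [::], [::]; split=> //; left.
  by rewrite gpath_cons => /and3P[_ /gstep_neq0].
rewrite gpath_cons => /and3P[_ _ tp]; case: (eqVneq x v) => [e|xv]; last first.
  by exists [::], ((x :: t) :: p); split=> //; right; exists x, t, p.
rewrite {}e in tp *; have [q [p2 [-> h]]] := IH _ tp.
by exists (t :: q), p2.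
Qed.

Lemma last_map_cons v s q : last (v :: s) (map (cons v) q) = v :: last s q.
Proof. exact: (last_map (cons v)). Qed.

Lemma gpath_jump C S v s q x t p : x != v ->
  gpath C S (v :: s) (map (cons v) q ++ (x :: t) :: p) ->
  [/\ dist C S x < dist C S v, perm_eq t (front (v :: last s q))
    & gpath C S (x :: t) p].
Proof.
by move=> xv /gpath_catr[]; rewrite last_map_cons /= eq_sym (negbTE xv) => /andP[].
Qed.

(** Every change of head strictly lowers its distance, so an abandoned head never becomes head
    again. *)
Lemma gpath_dist C S v s p u r : gpath C S (v :: s) p -> u :: r \in (v :: s) :: p ->
  dist C S u <= dist C S v ?= iff (u == v).
Proof.
elim: p v s => [|[|v' s'] p IH] v s.
- by rewrite inE => _ /eqP[-> _]; apply/leqif_refl; rewrite eqxx.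
- by rewrite gpath_cons => /and3P[_ /gstep_neq0].
rewrite gpath_cons => /and3P[_ /= vv' sp]; rewrite inE => /orP[/eqP[-> _]|up].
  by apply/leqif_refl; rewrite eqxx.
have := IH _ _ sp up; move: vv'; case: eqVneq => [<- _ //|vv' /andP[lt _] [le e]].
split; first by apply: leq_trans (ltnW lt).
rewrite (ltn_eqF (leq_ltn_trans le lt)); apply/esym/negbTE.
by apply: contraTneq (leq_ltn_trans le lt) => ->; rewrite ltnn.
Qed.

(** * The flag case: a vertex that has left does not return *)

(* If [w] is adjacent to the vertex [x] through which the target set is hit,
   then flagness keeps [w] adjacent to [x] in all the iterated links, so that
   [w] cannot leave before [x] enters. *)
Lemma flag_stays C S s p x w : is_complex C -> banner 2 C -> gpath C S s p ->
  (forall t y, t \in s :: p -> y \in t -> y \notin S) ->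
  x \in S -> [set z in x :: front (last s p)] \in C ->
  w \in s -> [set w; x] \in C -> w \in front (last s p).
Proof.
elim: s C S p => [//|v s IH] C S p cC bC gp dS xS fC ws wx.
have xw : x != w.
  apply: contraTneq ws => e; apply: contraL xS => h.
  by rewrite e; apply: dS h; rewrite mem_head.
have Av := gpath_head gp.
have vS : v \notin S by apply: (dS (v :: s)); rewrite mem_head.
have dx : dist C S x = 0 by apply/eqP; rewrite dist0.
(* [w] is within distance 1 through [x], and the nearest vertex [v] is outside [S]. *)
have dv : dist C S v = 1.
  have := dist_adj S cC wx (set21 w x) (set22 w x); rewrite dx.
  (* The minimality of the head and [v \notin S] give the two remaining bounds. *)
  have := afacet_min cC Av ws; have : dist C S v != 0 by rewrite dist0.
  lia.
(* A change of head would bring a vertex at distance 0, that is in [S], so the whole path is one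
   block. *)
have [q [p2 [ep hp2]]] := gpath_split gp; case: hp2 => [e2|[y [t [p3 [e2 yv]]]]]; last first.
  rewrite ep e2 in gp; have [] := gpath_jump yv gp; rewrite dv ltnS leqn0 dist0 => yS _ _.
  have /negP[] // : y \notin S.
  by apply: (dS (y :: t)); rewrite ?mem_head // ep e2 inE mem_cat mem_head !orbT.
move: ep; rewrite e2 cats0 => ep; rewrite {p e2}ep last_map_cons in gp dS fC *.
have in_map r : r \in s :: q -> v :: r \in (v :: s) :: map (cons v) q by apply: (map_f (cons v)).
set l := last s q in fC *.
have ls : l \in s :: q by apply: mem_last.
have Al := gpath_all gp (in_map _ ls).
have vx : v != x by apply: contraNneq vS => ->.
(* With empty tails [w] would be [v], and the facet [[set v]] would be properly contained in the
   edge to [x]. *)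
have l0 : l != [::].
  have sl : size (v :: l) = size (v :: s) := gpath_size gp (in_map _ ls).
  apply: contraNneq vx => e; move: sl Al ws; rewrite e.
  move=> -[] /esym/size0nil -> /andP[/andP[_ /facetP[_ mF]] _].
  rewrite inE => /eqP ew; have := mF _ wx; rewrite ew => h.
  have : x \in [set w; x] by rewrite set22.
  rewrite ew h ?inE; first by rewrite eq_sym.
  by apply/subsetP=> z; rewrite !inE => ->.
rewrite front_cons //; case: (eqVneq w v) => [->|wv]; first exact: mem_head.
rewrite inE (negbTE wv) /=; have {}ws : w \in s by move: ws; rewrite inE (negbTE wv).
have cL := afacet_complex cC Av.
have [/andP[ul _] _] := andP Al; case/andP: (ul) => vl _.
have xvlC : [set z in [:: x, v & front l]] \in C by move: fC; rewrite front_cons.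
have vxC : [set v; x] \in C.
  apply: complex_sub xvlC _ => //; apply/subsetP=> z; rewrite !inE orbC => /orP[]->//.
  by rewrite orbT.
have vwC : [set v; w] \in C by apply: afacet_pair Av _ _; rewrite ?mem_head // inE ws orbT.
apply: (IH (link C v) (target C S v) q) => //.
- by apply: link_banner => // T cT kT; apply: bC => //; apply: ltnW.
- exact: gpath_link.
- move=> r y rq yr; rewrite in_target // (negbTE vS) dv eqSS dist0.
  by rewrite negb_and (dS (v :: r)) ?orbT ?in_map // inE yr orbT.
- by rewrite in_target // (negbTE vS) in_verts_link // eq_sym vx vxC dx dv.
- rewrite in_link; apply/and3P; split.
  + apply: complex_sub xvlC _ => //; apply/subsetP=> z; rewrite !inE.
    by case/orP=> ->; rewrite ?orbT.
  + rewrite !inE negb_or vx /=; apply: contra vl; exact: mem_front.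
  + suff -> : v |: [set z in x :: front l] = [set z in [:: x, v & front l]] by [].
    by apply/setP=> z; rewrite !inE orbCA.
- rewrite in_link wx !inE negb_or (eq_sym v) wv vx /= setUA.
  by apply: flag3 => //; rewrite 1?eq_sym.
Qed.

(** Induction on facet size plus path length. A first block with [w] at both ends is handled in the
    link. If the head changes from [v] to [x], then [w] in the last facet forces that facet to have
    head [x], so [w] is adjacent to [x]; [flag_stays] keeps [w] through the change, and both pieces
    have [w] at their ends. *)
Lemma flag_convex n C S s p w : size s + size p < n ->
  is_complex C -> banner 2 C -> gpath C S s p ->
  w \in s -> w \in last s p -> forall t, t \in s :: p -> w \in t.
Proof.
elim: n C S s p => // n IH C S [//|v s] p sn cC bC gp ws wl.
have Av := gpath_head gp; have cL := afacet_complex cC Av.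
have bL : banner 2 (link C v).
  by apply: link_banner => // T cT kT; apply: bC => //; apply: ltnW.
have [q [p2 [ep hp2]]] := gpath_split gp.
have gq : gpath C S (v :: s) (map (cons v) q) by apply: gpath_catl (p2) _; rewrite -ep.
have first_block : w \in v :: last s q -> forall t, t \in (v :: s) :: map (cons v) q -> w \in t.
  move=> wq t; rewrite -[_ :: map _ _]/(map (cons v) (s :: q)) => /mapP[r rq ->].
  move: ws wq; rewrite !inE; case: eqVneq => //= _ ws wq.
  apply: (IH (link C v) (target C S v) s q) => //; last exact: gpath_link.
  by move: sn; rewrite ep size_cat size_map /=; clear; lia.
case: hp2 => [e2|[x [t [p3 [e2 xv]]]]].
  by move: ep; rewrite e2 cats0 => ep; rewrite ep; apply: first_block; rewrite -last_map_cons -ep.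
rewrite {p2}e2 in ep; rewrite {p}ep in sn gp wl *.
have [dx pt gt] := gpath_jump xv gp.
rewrite last_cat last_cons in wl.
have [u [r el]] : exists u r, last (x :: t) p3 = u :: r.
  by case: (last _ _) wl => // u r _; exists u, r.
have up : u :: r \in (x :: t) :: p3 by rewrite -el mem_last.
rewrite el in wl.
have Au := gpath_all gt up.
have [dux eux] := gpath_dist gt up.
have dw := afacet_min cC Av ws; have dw' := afacet_max cC Au wl.
(* The head distances satisfy [dist u <= dist x < dist v <= dist w <= dist u + 1], so all slack
   vanishes. *)
have {eux} ux : u = x.
  by apply/eqP; rewrite -eux eqn_leq dux -ltnS (leq_trans dx) // (leq_trans dw).
rewrite {u}ux in up el wl Au dux dw'.
have vw : dist C S v = dist C S w by move: dx dw dw'; clear; lia.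
have vx : dist C S v = (dist C S x).+1 by move: dx dw dw'; clear; lia.
have xw : x != w by apply: contraTneq dx => ->; rewrite vw ltnn.
set l := last s q in pt.
have Al : afacet C S (v :: l) by apply: (gpath_all gq); rewrite -last_map_cons mem_last.
have At := gpath_head gt; have [/andP[ut _] _] := andP At.
(* Otherwise all facets are single vertices and the last one, [[:: x]], would make [w] equal to
   [x]. *)
have l0 : l != [::].
  apply: contraTneq wl => e; move: (gpath_size gt up) (perm_size pt).
  by rewrite e /= => -[<-] /size0nil ->; rewrite inE eq_sym.
have vt : v \in t by rewrite (perm_mem pt) front_cons // mem_head.
have wx : [set w; x] \in C by apply: afacet_pair Au _ _; rewrite ?mem_head.
have vxC : [set v; x] \in C by apply: afacet_pair At _ _; rewrite ?mem_head // inE vt orbT.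
have vS : v \notin S by rewrite -(dist0 C) vx.
have vneqx : v != x by rewrite eq_sym.
have wfl : w \in front (v :: l).
  rewrite front_cons // inE; case: (eqVneq w v) => //= wv.
  have {}ws : w \in s by move: ws; rewrite inE (negbTE wv).
  have vwC : [set v; w] \in C by apply: afacet_pair Av _ _; rewrite ?mem_head // inE ws orbT.
  apply: (flag_stays (C := link C v) (S := target C S v) (s := s) (x := x)) => //.
  - exact: gpath_link.
  - move=> r' y rq yr; rewrite in_target // (negbTE vS) negb_and; apply/orP; right.
    have Ar : afacet C S (v :: r').
      by apply: (gpath_all gq); apply: (map_f (cons v) rq).
    have := afacet_min (x := y) cC Ar; rewrite inE yr orbT => /(_ isT).
    by rewrite leqNgt => /negbTE h; apply/eqP => e; rewrite -e ltnS leqnn in h.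
  - by rewrite in_target // (negbTE vS) in_verts_link // xv vxC vx eqxx.
  - have xtC := ordered_facet_face (proj1 (andP At)).
    have e : [set z in x :: t] = v |: [set z in x :: front l].
      apply/setP=> z; rewrite !inE (perm_mem pt) front_cons // inE orbCA.
      by [].
    rewrite e in xtC; rewrite in_link xtC andbT; apply/andP; split.
      by apply: complex_sub xtC _ => //; apply: subsetUr.
    rewrite !inE negb_or vneqx; have [/andP[/andP[vl _] _] _] := andP Al.
    by apply: contra vl; apply: mem_front.
  - rewrite in_link wx !inE negb_or (eq_sym v) wv vneqx /= setUA.
    by apply: flag3 => //; rewrite 1?eq_sym.
move=> r'; rewrite -cat_cons mem_cat => /orP[]; first by apply: first_block; apply: mem_front.
apply: (IH C S (x :: t) p3) => //; last 2 first.
- by rewrite inE (perm_mem pt) wfl orbT.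
- by rewrite el.
have: size (x :: t) = size (v :: s).
  rewrite /= (perm_size pt) size_front // (gpath_size gq (t := v :: l)) //.
  by rewrite -last_map_cons mem_last.
by move: sn; rewrite size_cat /=; clear; lia.
Qed.

(** * Counting entries and bounding the length *)

(* The number of times that [w] enters along [p], where [b] tells whether the
   facet preceding [p] contains [w]. *)
Fixpoint entries w (b : bool) p : nat :=
  if p is t :: p' then (~~ b && (w \in t)) + entries w (w \in t) p' else 0.

Lemma entries_le w b p : entries w b p <= entries w false p.
Proof. by case: p => // t p /=; rewrite leq_add2r; case: b (w \in t) => [] []. Qed.

(** Restarting the count with [false] at the junction can only overcount. *)
Lemma entries_cat w b p q :
  entries w b (p ++ q) <= entries w b p + entries w false q.
Proof.
elim: p b => [|t p IH] b; first exact: entries_le.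
by rewrite /= -addnA leq_add2l.
Qed.

Lemma entries0 w b p : (forall t, t \in p -> w \notin t) -> entries w b p = 0.
Proof.
elim: p b => //= t p IH b h; rewrite (negbTE (h t _)) ?mem_head // andbF IH // => r rp.
by rewrite h // inE rp orbT.
Qed.

Lemma entries_all w p : (forall t, t \in p -> w \in t) -> entries w true p = 0.
Proof.
elim: p => //= t p IH h; rewrite (h t) ?mem_head // IH // => r rp.
by rewrite h // inE rp orbT.
Qed.

Lemma entries_map_cons w v b q : w != v -> entries w b (map (cons v) q) = entries w b q.
Proof. by move=> wv; elim: q b => //= t q IH b; rewrite inE (negbTE wv) IH. Qed.

Lemma entries_flag C S s p w : is_complex C -> banner 2 C -> gpath C S s p ->
  entries w false (s :: p) <= 1.
Proof.
move=> cC bC; elim: p s => [|t p IH] s gp /=; first by rewrite addn0 leq_b1.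
have gt : gpath C S t p by move: (gp); rewrite gpath_cons => /and3P[].
case: (boolP (w \in s)) => ws /=; last exact: IH gt.
case: (boolP (w \in t)) => wt /=; first by have := IH _ gt; rewrite /= wt.
rewrite entries0 // => r /splitPr sp; case: sp gp => a b gp.
apply: contra wt => wr.
(* A return at [r] would put [w], by convexity between [s] and [r], on the facet [t] that it had
   left. *)
have gr : gpath C S s (t :: rcons a r).
  by apply: gpath_catl (b) _; rewrite cat_cons cat_rcons.
apply: (flag_convex (ltnSn _) cC bC gr ws); first by rewrite /= last_rcons.
by rewrite !inE eqxx orbT.
Qed.

(* A vertex [w] at distance [m] from [S] lies only on facets whose head is at
   distance [m] or [m - 1]; each of these two blocks of facets with a common
   head is a path in the link of the head, which is banner of smaller index. *)
Lemma entries_bound j C S s p w : is_complex C -> banner j.+2 C -> gpath C S s p ->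
  entries w false (s :: p) <= 2 ^ j.
Proof.
elim: j C S s p => [|j IHj] C S s p cC bC gp; first exact: entries_flag gp.
case: s gp => [|v s] gp.
  case: p gp => [|t p] //.
  by rewrite gpath_cons => /and3P[].
(* The indicators count the levels [dist w] and [dist w - 1] that the head distance has not yet
   passed. *)
suff h : entries w false ((v :: s) :: p) <=
    2 ^ j * ((dist C S w <= dist C S v) + (dist C S w <= (dist C S v).+1)).
  apply: leq_trans h _; rewrite expnSr leq_mul2l; apply/orP; right.
  exact: leq_add (leq_b1 _) (leq_b1 _).
have [n] := ubnP (size p); elim: n v s p gp => // n IHn v s p gp pn.
have Av := gpath_head gp.
have [q [p2 [ep hp2]]] := gpath_split gp.
have gq : gpath C S (v :: s) (map (cons v) q) by apply: gpath_catl (p2) _; rewrite -ep.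
have cL := afacet_complex cC Av.
have block : entries w false (map (cons v) (s :: q)) <=
    2 ^ j * ((dist C S v <= dist C S w) && (dist C S w <= (dist C S v).+1)).
  case: andP => [_|nd]; last first.
    rewrite muln0 entries0 // => t tq; apply/negP => wt; apply: nd.
    have At := gpath_all gq tq.
    move: tq At wt => /mapP[r _ ->] At wt.
    by split; [apply: afacet_min At _ | apply: afacet_max At _].
  rewrite muln1; case: (eqVneq w v) => [->|wv].
    rewrite /= mem_head entries_all ?addn0 ?expn_gt0 // => t /mapP[r _ ->].
    exact: mem_head.
  rewrite entries_map_cons //; apply: (IHj (link C v) (target C S v)) => //.
    exact: link_banner.
  exact: gpath_link.
have -> : (v :: s) :: p = map (cons v) (s :: q) ++ p2 by rewrite ep.
case: hp2 => [->|[x [t [p3 [e2 xv]]]]].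
  rewrite cats0; apply: leq_trans block _; rewrite leq_mul2l; apply/orP; right.
  by apply: leq_trans (leq_addl _ _); case: (dist C S v <= _).
rewrite {p2}e2 in ep *; rewrite ep in gp pn.
have [dx pt gt] := gpath_jump xv gp.
apply: leq_trans (entries_cat _ _ _ _) _.
apply: leq_trans (leq_add block (IHn _ _ _ gt _)) _.
  by move: pn; rewrite size_cat /=; clear; lia.
(* As [dist x < dist v], the level used by the first block is no longer counted after the change of
   head. *)
rewrite -mulnDr leq_mul2l; apply/orP; right.
by move: dx; clear; move: (dist C S v) (dist C S w) (dist C S x) => a b c; lia.
Qed.

(** Each step brings in a vertex absent before, so it adds at least one entry to the sum. *)
Lemma gpath_size_entries C S s p : is_complex C -> gpath C S s p ->
  size p <= \sum_(w in verts C) entries w (w \in s) p.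
Proof.
move=> cC; elim: p s => //= t p IH s; rewrite gpath_cons => /and3P[As st gt].
have /andP[ot _] := gpath_head gt; have /andP[ut _] := ot.
have [x xs pt] := gstep_perm cC st As ut; have xt : x \in t by rewrite (perm_mem pt) mem_head.
rewrite big_split /= -add1n leq_add ?IH // (bigD1 x) /= ?xs ?xt ?leq_addr //.
exact: ordered_facet_in ot xt.
Qed.

Lemma gpath_bound j C S s p : is_complex C -> banner j.+2 C -> gpath C S s p ->
  size p <= #|verts C| * 2 ^ j.
Proof.
move=> cC bC gp; apply: leq_trans (gpath_size_entries cC gp) _.
rewrite -sum_nat_const; apply: leq_sum => w _.
apply: leq_trans (entries_bound w cC bC gp); rewrite /= leq_addl //.
Qed.

(** * Existence of admissible orderings and of steps *)

(** Stated for arbitrary sets, so that the recursion into links carries no side conditions. *)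
Definition admissible_ordering C S F s := [/\ uniq s, s =i F & admissible C S s].

Lemma admissible_ordering_cons C S F v s : v \in F ->
  (forall y, y \in F -> dist C S v <= dist C S y) ->
  admissible_ordering (link C v) (target C S v) (F :\ v) s ->
  admissible_ordering C S F (v :: s).
Proof.
move=> vF vmin [us sF As]; split.
- by rewrite /= us sF setD11.
- by move=> y; rewrite inE sF in_setD1; case: (eqVneq y v) => [->|].
- by rewrite admissible_cons As andbT; apply/allP=> y; rewrite sF => /setD1P[_ /vmin].
Qed.

(** Greedy: put a nearest vertex first and recurse in its link. *)
Lemma admissible_ordering_exists C S F : exists s, admissible_ordering C S F s.
Proof.
have [n] := ubnP #|F|; elim: n C S F => // n IH C S F Fn.
case: (set_0Vmem F) => [->|[x xF]]; first by exists [::]; split=> // x; rewrite inE.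
have [v vF vmin] := @arg_minnP _ x (fun y => y \in F) (dist C S) xF.
have [|s Hs] := IH (link C v) (target C S v) (F :\ v).
  by move: Fn; rewrite (cardsD1 v) vF.
by exists (v :: s); apply: admissible_ordering_cons Hs.
Qed.

Lemma mem_set_seq s F : s =i F -> [set x in s] = F.
Proof. by move=> sF; apply/setP=> x; rewrite inE sF. Qed.

Lemma afacet_exists C S F : facet C F -> exists2 s, afacet C S s & [set x in s] = F.
Proof.
move=> fF; have [s [us sF As]] := admissible_ordering_exists C S F.
by exists s; rewrite /afacet /ordered_facet ?us ?As (mem_set_seq sF) ?fF.
Qed.

Lemma facet_exists C v : v \in verts C -> exists2 F, facet C F & v \in F.
Proof.
rewrite inE => vC; have [F fF vF] := maxset_exists (P := fun f => f \in C) vC.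
by exists F => //; rewrite -sub1set.
Qed.

(** Normality joins a facet at [v] to one at [z]; consecutive facets share a vertex since [1 < d],
    so finiteness travels back along the path. *)
Lemma dist_fin C S d v z : is_complex C -> pure d C -> normal C -> 1 < d ->
  v \in verts C -> z \in verts C -> z \in S -> dist C S v <= cardV.+1.
Proof.
move=> cC pC nC d1 vC zC zS; have [F fF vF] := facet_exists vC.
have [G fG zG] := facet_exists zC; have [P [pP lP _]] := nC _ _ fF fG.
have hG y : y \in last F P -> dist C S y <= cardV.+1.
  rewrite lP => yG; have /facetP[GC _] := fG; apply: (dist_fin_adj cC GC yG zG).
  by have /eqP-> : dist C S z == 0 by rewrite dist0.
elim: P F pP v vF hG {vC fF lP} => [|H P IH] F pP v vF hG; first exact: hG.
case/andP: pP => /and4P[fF fH /eqP h1 _] pP.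
have /set0Pn[y] : F :&: H != set0.
  by rewrite -card_gt0; have := cardsID H F; rewrite h1 (pC _ fF) => e; rewrite -(ltn_add2r 1) e.
rewrite inE => /andP[yF yH]; have /facetP[FC _] := fF.
by apply: (dist_fin_adj cC FC vF yF); apply: (IH H).
Qed.

(** If [v] is still nearest, it stays head. Otherwise only the entering vertex [x] can be closer,
    since the others were in the old facet, and [x] becomes head. *)
Lemma gstep_lift C S v s t : is_complex C -> afacet C S (v :: s) ->
  afacet (link C v) (target C S v) t -> gstep (link C v) (target C S v) s t ->
  exists2 t', afacet C S t' & gstep C S (v :: s) t'.
Proof.
move=> cC Av At st; have cL := afacet_complex cC Av.
have As : afacet (link C v) (target C S v) s by move: Av; rewrite afacet_cons // => /andP[].
have [ot _] := andP At; have [ut _] := andP ot.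
have [x xs pt] := gstep_perm cL st As ut.
have ov : ordered_facet C (v :: t) by rewrite ordered_facet_cons.
have minf y : y \in front s -> dist C S v <= dist C S y.
  by move=> /mem_front ys; apply: afacet_min cC Av _; rewrite inE ys orbT.
case: (boolP (all (fun y => dist C S v <= dist C S y) t)) => [ha|].
  by exists (v :: t); rewrite ?afacet_cons ?ha //= eqxx.
case/allPn=> y; rewrite (perm_mem pt) -ltnNge inE => /orP[/eqP->|/minf]; last first.
  by rewrite leqNgt => /negbTE ->.
move=> xv {y}; have xneqv : x != v by apply: contraTneq xv => ->; rewrite ltnn.
(* Behind the new head the order is chosen afresh; [gstep] asks only for a permutation of the
   surviving vertices. *)
have [r Hr] := admissible_ordering_exists (link C x) (target C S x) ([set y in v :: t] :\ x).
have [||ur rF Ar] := admissible_ordering_cons _ _ Hr.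
- by rewrite !inE (perm_mem pt) mem_head orbT.
- move=> y; rewrite !inE (perm_mem pt) inE => /or3P[/eqP->|/eqP->//|/minf]; first exact: ltnW.
  by apply: leq_trans; apply: ltnW.
exists (x :: r).
  by rewrite /afacet Ar andbT /ordered_facet ur (mem_set_seq rF); case/andP: ov.
have [s0 _] := andP (gstep_neq0 st).
have [/andP[uv _] _] := andP Av.
rewrite /= eq_sym (negbTE xneqv) xv /= -[belast v s]/(front (v :: s)).
apply: uniq_perm; [by case/andP: ur | exact: uniq_front | move=> y].
have := rF y; rewrite !inE (perm_mem pt) front_cons // !inE.
case: (eqVneq y x) => [->|] //= _; rewrite (negbTE xneqv) /=.
have xf : x \in front s = false by apply: contraNF xs => /mem_front.
by case/andP: ur => /negbTE-> _; rewrite xf.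
Qed.

(* Towards a target set disjoint from the facet, a step exists because the
   target sets in the iterated links stay nonempty and disjoint from it. *)
Lemma gstep_exists_disjoint C d S s z : is_complex C -> pure d C -> normal C ->
  s != [::] -> afacet C S s -> z \in verts C -> z \in S ->
  (forall y, y \in s -> y \notin S) ->
  exists2 t, afacet C S t & gstep C S s t.
Proof.
elim: s C d S z => // v s IH C d S z cC pC nC _ Av zC zS dS.
have vS : v \notin S by apply: dS; rewrite mem_head.
have vz : v != z by apply: contraNneq vS => ->.
have [/andP[us fs] _] := andP Av.
have sd : size (v :: s) = d by rewrite -(pC _ fs) cardsE (card_uniqP us).
case: (eqVneq s [::]) => [s0|s0].
  (* Facets are single vertices here, so one step goes straight to [z]. *)
  exists [:: z]; last first.
    have /eqP dz : dist C S z == 0 by rewrite dist0.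
    by rewrite /= (negbTE vz) s0 perm_refl andbT dz lt0n dist0 vS.
  rewrite afacet_cons //= /afacet /ordered_facet /= andbT facet_link //.
  have [F fF zF] := facet_exists zC.
  have <- : F = z |: [set x in [::]]; last by rewrite inE in_nil fF.
  have /cards1P[y ey] : #|F| == 1 by rewrite pC // -sd s0.
  by move: zF; rewrite ey inE => /eqP ->; apply/setP=> u; rewrite !inE orbF.
have d1 : 1 < d by rewrite -sd; case: (s) s0.
have vC : v \in verts C by apply: (facet_vert cC fs); rewrite inE mem_head.
have nD : ~~ dim0 C.
  apply/negP => dC; case: (s) s0 us fs => // u r _ /andP[vu _] /facetP[sC _].
  have e : v = u by apply: (dim0_pair dC sC); rewrite !inE eqxx ?orbT.
  by rewrite e mem_head in vu.
have dv := dist_Some (dist_fin cC pC nC d1 vC zC zS).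
have d0 : 0 < dist C S v by rewrite lt0n dist0.
rewrite -(prednK d0) in dv.
(* A neighbour of [v] one closer to [S] witnesses that the target set in the link is nonempty. *)
have [w wL /vdist_dist[dw _]] := vdist_step cC nD dv.
have As : afacet (link C v) (target C S v) s by move: Av; rewrite afacet_cons // => /andP[].
have cL := afacet_complex cC Av.
have [||t At st] := IH _ _ (target C S v) w cL (link_pure cC pC) (link_normal cC nC) s0 As wL.
- by rewrite in_target // wL (negbTE vS) dw prednK ?eqxx.
- move=> y ys; rewrite in_target // (negbTE vS) negb_and; apply/orP; right.
  have := afacet_min (x := y) cC Av; rewrite inE ys orbT => /(_ isT).
  by rewrite leqNgt => /negbTE h; apply/eqP => e; rewrite -e ltnS leqnn in h.
exact: gstep_lift At st.
Qed.

(** A head outside [G] is nearest, so the facet is disjoint from [G]. A head in [G] makes the next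
    target [G :\ v], a facet of the link, and the argument recurses. *)
Lemma gstep_exists C d G s : is_complex C -> pure d C -> normal C ->
  facet C G -> afacet C G s -> [set x in s] <> G ->
  exists2 t, afacet C G t & gstep C G s t.
Proof.
elim: s C d G => [|v s IH] C d G cC pC nC fG Av neq.
  have [/andP[_ /facetP[_ mF]] _] := andP Av; have /facetP[GC _] := fG.
  by case: neq; rewrite (mF G) //; apply/subsetP=> x; rewrite inE.
have [/andP[us fs] _] := andP Av.
case: (boolP (v \in G)) => vG; last first.
  have /card_gt0P[z zG] : 0 < #|G|.
    rewrite (pC _ fG) -(pC _ fs); apply/card_gt0P; exists v.
    by rewrite inE mem_head.
  apply: (gstep_exists_disjoint cC pC nC _ Av _ zG) => //; first exact: (facet_vert cC fG).
  move=> y ys; rewrite -(dist0 C) -lt0n; apply: leq_trans (afacet_min cC Av ys).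
  by rewrite lt0n dist0.
have tG : target C G v = G :\ v.
  apply/setP=> y; rewrite in_target // vG in_verts_link // in_setD1.
  case: (boolP (y \in G)) => yG; rewrite ?andbF // !andbT.
  have /facetP[GC _] := fG; suff -> : [set v; y] \in C by rewrite andbT.
  by apply: complex_sub GC _ => //; rewrite subUset !sub1set vG.
have As : afacet (link C v) (target C G v) s by move: Av; rewrite afacet_cons // => /andP[].
have [||t At st] := IH _ _ _ (afacet_complex cC Av) (link_pure cC pC) (link_normal cC nC) _ As.
- by rewrite tG; apply: facet_linkD.
- by rewrite tG => e; apply: neq; rewrite set_cons e setD1K.
exact: gstep_lift At st.
Qed.

(** * Termination of the path *)

(* The vector of distances read as a number in base [#|V| + 3]. *)
Fixpoint rank C S s : nat :=
  if s is v :: s' then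
    dist C S v * cardV.+3 ^ size s' + rank (link C v) (target C S v) s'
  else 0.

Lemma dist_le C S v : dist C S v <= cardV.+2.
Proof. by rewrite /dist; case h: vdist => [m|] //=; have := vdist_bound h; lia. Qed.

Lemma rank_lt C S s : rank C S s < cardV.+3 ^ size s.
Proof.
elim: s C S => [|v s IH] C S; first by rewrite expn0.
rewrite expnS /=; apply: leq_trans (_ : (dist C S v).+1 * cardV.+3 ^ size s <= _).
  by rewrite mulSn addnC ltn_add2r.
by rewrite leq_mul2r ltnS dist_le orbT.
Qed.

Lemma gstep_rank C S s t : gstep C S s t -> rank C S t < rank C S s.
Proof.
elim: s C S t => [|v s IH] C S [|w t] //= st.
have sz : size t = size s by have [] := gstep_size (st : gstep C S (v :: s) (w :: t)).
move: st; rewrite sz; case: eqVneq => [<- /IH|_ /andP[lt _]]; first by rewrite ltn_add2l.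
apply: leq_trans (leq_addr _ _).
apply: leq_trans (_ : (dist C S w).+1 * cardV.+3 ^ size s <= _).
  by rewrite mulSn addnC ltn_add2r -sz rank_lt.
by rewrite leq_mul2r lt orbT.
Qed.

Lemma gpath_exists C d G s : is_complex C -> pure d C -> normal C ->
  facet C G -> afacet C G s ->
  exists2 p, gpath C G s p & [set x in last s p] = G.
Proof.
move=> cC pC nC fG; have [n] := ubnP (rank C G s); elim: n s => // n IH s sn As.
case: (eqVneq [set x in s] G) => [e|/eqP neq].
  by exists [::]; rewrite ?gpath_nil.
have [t At st] := gstep_exists cC pC nC fG As neq.
have [|p tp lp] := IH t _ At; first exact: leq_trans (gstep_rank st) _.
by exists (t :: p); rewrite ?gpath_cons ?As ?st.
Qed.

(** * Steps are monotone, conservative and dual *)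

Lemma gstep_lexlt C S s t : gstep C S s t -> lexlt (vecdist C S t) (vecdist C S s).
Proof.
elim: s C S t => [|v s IH] C S [|w t] //=; case: eqVneq => [<- /IH->|_ /andP[lt _]].
  by rewrite eqxx orbT.
by rewrite dlt_vdist lt.
Qed.

(** Where [t] leaves [s], its new head is closer than the old one, so an admissible reordering that
    agrees with [s] up to there cannot keep the old head. *)
Lemma gstep_index C S s t t' : gstep C S s t -> admissible C S t' ->
  perm_eq t' t -> step_index s t' <= step_index s t.
Proof.
rewrite /step_index ltnS.
elim: s C S t t' => [|v s IH] C S [|w t] [|w' t'] // st adt pt.
rewrite admissible_cons in adt; case/andP: adt => /allP mt adt.
move: st pt mt adt => /=; case: (eqVneq v w) => [<-|vw] st; case: (eqVneq v w') => //= <- pt mt adt.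
  by apply: IH st adt _; rewrite -(perm_cons v).
have : w \in v :: t' by rewrite (perm_mem pt) mem_head.
by case/andP: st => lt _; rewrite inE eq_sym (negbTE vw) => /mt; rewrite leqNgt lt.
Qed.

Lemma notin_front s x y : x \in s -> x \notin front s -> last y s = x.
Proof.
case/lastP: s => // s z; rewrite front_rcons mem_rcons last_rcons inE.
by case/orP=> [/eqP|->].
Qed.

Lemma gstep_conservative C S s t : is_complex C -> afacet C S s -> afacet C S t ->
  gstep C S s t -> conservative_step C S s t.
Proof.
move=> cC As /andP[/andP[ut _] adt] st.
have [x _ pt] := gstep_perm cC st As ut; apply/and3P; split=> //.
  apply/forallP=> v; apply/implyP=> /andP[vs]; rewrite (perm_mem pt) inE negb_or => /andP[_ vf].
  by apply/eqP/notin_front.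
apply/allP=> t'; rewrite mem_permutations => pt'; apply/implyP=> adt'.
exact: gstep_index adt' pt'.
Qed.

Lemma gstep_dual_adj C S s t : is_complex C -> afacet C S s -> afacet C S t ->
  gstep C S s t -> dual_adj C [set x in s] [set x in t].
Proof.
move=> cC As /andP[/andP[ut ft] _] st.
have [x xs pt] := gstep_perm cC st As ut.
have [/andP[us fs] _] := andP As; have [s0 _] := andP (gstep_neq0 st).
rewrite /dual_adj fs ft /=; apply/andP; split; apply/cards1P.
  case/lastP: s s0 us xs pt {As st fs} => // s v _; rewrite rcons_uniq mem_rcons front_rcons.
  rewrite inE negb_or => /andP[vs _] /andP[xv _] pt; exists v; apply/setP=> y.
  rewrite !inE (perm_mem pt) mem_rcons !inE negb_or.
  case: (eqVneq y v) => [->|_] /=; first by rewrite eq_sym xv vs.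
  by case: (y \in s); rewrite ?andbF.
exists x; apply/setP=> y; rewrite !inE (perm_mem pt) inE.
case: (eqVneq y x) => [->|_] /=; first by rewrite xs.
by case: (boolP (y \in front s)) => [/mem_front->|]; rewrite ?andbF.
Qed.

End Paths.

Theorem theorem1p3 (V : finType) (C : {set {set V}}) (k n d : nat)
    (hk : 2 <= k)
    (hC : is_complex C)
    (hn : #|verts C| = n)
    (hpure : pure d C)
    (hnormal : normal C)
    (hbanner : banner k C)
    (F1 F2 : {set V})
    (hF1 : facet C F1)
    (hF2 : facet C F2)
    (hF12 : F1 <> F2) :
  exists (s : seq V) (p : seq (seq V)),
    monotone_conservative_path C F1 F2 s p /\ size p <= n * 2 ^ (k - 2).
Proof.
have [s As sF1] := afacet_exists F2 hF1.
have [p gp lp] := gpath_exists hC hpure hnormal hF2 As.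
exists s, p; split; last first.
  (* Writing [k] as [j.+2] matches the exponent [j] of the bound with [k - 2]. *)
  by rewrite -hn; apply: gpath_bound gp => //; case: k hk hbanner => [|[|j]] //; rewrite subn2.
have [Ap sp] := andP gp; split=> //.
- apply/andP; split; first by apply: sub_all Ap => t /andP[].
  apply: sub_in_path Ap sp => t t' At At'; exact: gstep_dual_adj.
- rewrite /monotone_path /= path_map; apply: sub_path sp => t t'; exact: gstep_lexlt.
- rewrite /conservative_path; have [/andP[_ ->] _] := andP Ap.
  by apply: sub_in_path Ap sp => t t' At At'; exact: gstep_conservative.
Qed.
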